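(* Let $(N,v)$ be a transferable utility game with $N=\{1,\dots,n\}$ and $\Pi(v)\neq\emptyset$, and let $\delta>0$ be such that every value $v(S)$, $S\subseteq N$, is an integer multiple of $\delta$ and there exists $(\mathbf{x},\rho)\in\Pi(v)$ with every $x_i$ an integer multiple of $\delta$. Run the Coalition Proposal algorithm (described in the context) on $(N,v)$ with step $\delta$ for infinitely many iterations. Then, with probability $1$, the environment state $(\mathbf{a},\mathcal{C})$ converges to (i.e., eventually becomes and remains equal to) some state $(\mathbf{x},\rho)\in\Pi(v)$.
   Context: A transferable utility (TU) game is a pair $(N,v)$ with $N=\{1,\dots,n\}$ and $v:2^N\to\mathbb{R}$, $v(\emptyset)=0$. An allocation is $\mathbf{x}\in\mathbb{R}^n$. $\mathcal{P}(N)$ denotes the set of partitions of $N$. A core solution is a pair $(\mathbf{x},\rho)$ with $\mathbf{x}\in\mathbb{R}^n$, $\rho\in\mathcal{P}(N)$, such that $\sum_{i\in S}x_i\ge v(S)$ for all $S\subseteq N$ and $\sum_{i\in S}x_i=v(S)$ for all $S\in\rho$; $\Pi(v)$ is the set of core solutions. Coalition Proposal algorithm with step $\delta$: each player $i$ holds an aspiration $a_i$ and a coalition state $C_i\subseteq N$. Initially $a_i$ is an arbitrary integer multiple of $\delta$ and $C_i=\emptyset$. In each iteration: a player $i\in N$ is activated at random; $i$ chooses at random a set $S\subseteq N\setminus\{i\}$ and proposes $J=S\cup\{i\}$ (the random choices are made independently across iterations, every player and every subset having positive probability). If $\sum_{j\in J}a_j+\delta\le v(J)$ (success): $a_i\leftarrow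 a_i+\delta$; then for every $j\in J$ and every $k\in C_j$ with $k\neq j$, set $C_k\leftarrow\emptyset$; then set $C_j\leftarrow J$ for all $j\in J$. Otherwise (failure): if $C_i=\emptyset$, set $a_i\leftarrow\max(v(\{i\}),a_i-\delta)$. Finally, if $a_i=v(\{i\})$ and $C_i=\emptyset$, set $C_i\leftarrow\{i\}$. The environment state at an iteration is $(\mathbf{a},\mathcal{C})$, where $\mathbf{a}=(a_1,\dots,a_n)$ and $\mathcal{C}=\{C_i:i\in N\}$ is the set of (nonempty) formed coalitions. *)

(* Defs.v *)
From HB Require Import structures.
From mathcomp Require Import all_boot all_order all_algebra.
From mathcomp Require Import all_classical all_reals all_analysis.
Set Implicit Arguments. Unset Strict Implicit. Unset Printing Implicit Defensive.
Import Order.TTheory GRing.Theory Num.Theory.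
Local Open Scope ring_scope.

Section CoalitionProposal.
Variables (R : realType) (n : nat).

Definition tu_game (v : {set 'I_n} -> R) : Prop := v finset.set0 = 0.

Definition core_solution (v : {set 'I_n} -> R) (x : 'I_n -> R)
    (rho : {set {set 'I_n}}) : Prop :=
  finset.partition rho [set: 'I_n] /\
  (forall S : {set 'I_n}, v S <= \sum_(i in S) x i) /\
  (forall S : {set 'I_n}, S \in rho -> \sum_(i in S) x i = v S).

Definition multiple_of (delta r : R) : Prop := exists z : int, r = z%:~R * delta.

Record cp_state := CPState { asp : 'I_n -> R ; coal : 'I_n -> {set 'I_n} }.

(* a random choice: the activated player i and the set S (i \notin S) *)
Definition cp_choice := ('I_n * {set 'I_n})%type.

Definition cp_step (v : {set 'I_n} -> R) (delta : R) (st : cp_state)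
    (ch : cp_choice) : cp_state :=
  let i := ch.1 in
  let J := i |: ch.2 in
  let a := asp st in
  let C := coal st in
  let '(a', C') :=
    if \sum_(j in J) a j + delta <= v J then
      ((fun k => if k == i then a k + delta else a k),
       (fun k => if k \in J then J
                 else if [exists j in J, (k \in C j) && (k != j)] then finset.set0
                 else C k))
    else
      ((fun k => if (k == i) && (C i == finset.set0)
                 then Num.max (v [set i]) (a i - delta) else a k),
       C) in
  CPState a'
    (fun k => if (k == i) && (a' i == v [set i]) && (C' i == finset.set0)
              then [set i] else C' k).

Fixpoint cp_run (v : {set 'I_n} -> R) (delta : R) (a0 : 'I_n -> R)
    (ch : nat -> cp_choice) (k : nat) : cp_state :=
  match k with
  | 0 => CPState a0 (fun _ => finset.set0)
  | k'.+1 => cp_step v delta (cp_run v delta a0 ch k') (ch k')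
  end.

Definition formed (st : cp_state) : {set {set 'I_n}} :=
  [set coal st i | i : 'I_n] :\ finset.set0.

End CoalitionProposal.

(* Main.v *)
Require Import Defs.
From HB Require Import structures.
From mathcomp Require Import all_boot all_order all_algebra.
From mathcomp Require Import all_classical all_reals all_analysis.
From mathcomp Require Import zify lra.
Import Order.TTheory GRing.Theory Num.Theory numFieldNormedType.Exports.
Local Open Scope ring_scope.

(** Fix a core solution (x, rho) with x on the delta-grid. From any reachable
    state some player can be made to move towards x: a member i of a coalition
    admitting a successful proposal with a_i < x_i, or an idle player with
    a_i > x_i. When neither exists, summing aspirations over the current
    coalitions and over rho shows that a is itself a core allocation, tight on
    rho. Then an idle player lowers his aspiration by delta and immediately
    recovers it by proposing his block of rho; this completes one more block of
    rho without breaking any other. Hence a final state is always reachable.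

    Reachable aspirations stay in a bounded part of the grid, so only finitely
    many states matter; concatenating words that finish these states one after
    the other yields a single word of choices leading every one of them to a
    final state. Almost surely this word occurs as one of the disjoint blocks of
    choices, and final states are never left. *)

Section Dynamics.
Local Set Implicit Arguments.
Local Unset Strict Implicit.
Variables (R : realType) (n : nat) (v : {set 'I_n} -> R) (delta : R).
Hypothesis delta_gt0 : 0 < delta.

Implicit Types (st : cp_state R n) (i j k : 'I_n) (J S : {set 'I_n}).

(** * Arithmetic on the grid of multiples of [delta] *)

Lemma multiple_ofD (a b : R) :
  multiple_of delta a -> multiple_of delta b -> multiple_of delta (a + b).
Proof. by move=> [y ->] [z ->]; exists (y + z); rewrite intrD mulrDl. Qed.

Lemma multiple_ofN (a : R) : multiple_of delta a -> multiple_of delta (- a).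
Proof. by move=> [y ->]; exists (- y); rewrite mulrNz mulNr. Qed.

Lemma multiple_of_delta : multiple_of delta delta.
Proof. by exists 1; rewrite mul1r. Qed.

Lemma multiple_of_sum (J : {set 'I_n}) (a : 'I_n -> R) :
  (forall i, multiple_of delta (a i)) -> multiple_of delta (\sum_(i in J) a i).
Proof.
move=> ha; elim/big_ind : _ => // [|x y]; last exact: multiple_ofD.
by exists 0; rewrite mul0r.
Qed.

(** Turns any strict inequality between grid points into room for one full step of the algorithm. *)
Lemma multiple_of_lt (a b : R) :
  multiple_of delta a -> multiple_of delta b -> a < b -> a + delta <= b.
Proof.
move=> [y ->] [z ->]; rewrite ltr_pM2r// ltr_int => yz.
by rewrite -{2}(mul1r delta) -mulrDl ler_pM2r// -(intrD _ y 1) ler_int; lia.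
Qed.

Lemma sum_upd (J : {set 'I_n}) i (a b : 'I_n -> R) : i \in J ->
  (forall j, j != i -> b j = a j) ->
  \sum_(j in J) b j = \sum_(j in J) a j - a i + b i.
Proof.
move=> iJ hb; rewrite (big_setD1 i)//= [in RHS](big_setD1 i)//=.
rewrite (eq_bigr a) => [|j]; last by rewrite !inE => /andP[/hb].
by lra.
Qed.

(** * One iteration, split into success, busy failure and idle failure *)

Definition success st i J := \sum_(j in J) asp st j + delta <= v J.

(** Equivalently, the nonempty values of [C] are disjoint blocks, each held by exactly its
    members. *)
Definition consistent (C : 'I_n -> {set 'I_n}) : Prop :=
  (forall i, C i != finset.set0 -> i \in C i) /\
  (forall i k, k \in C i -> C k = C i).

(** The closing rule that forms {i} cannot fire after a success, since [i] then holds the nonempty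
    set [J]. *)
Lemma step_success st i S (J := i |: S) : success st i J ->
  cp_step v delta st (i, S) =
  CPState (fun k => if k == i then asp st k + delta else asp st k)
    (fun k => if k \in J then J
              else if [exists j in J, (k \in coal st j) && (k != j)]
                   then finset.set0 else coal st k).
Proof.
rewrite /success /J /cp_step /= => ->; congr CPState.
apply: funext => k; case: eqP => //= ->; rewrite setU11.
case: ifP => // /andP[_ /eqP iS0].
by have := setU11 i S; rewrite iS0 inE.
Qed.

Lemma step_busy st i S : ~~ success st i (i |: S) -> coal st i != finset.set0 ->
  cp_step v delta st (i, S) = st.
Proof.
rewrite /success /cp_step /= => /negbTE -> Ci; case: st Ci => a C /= Ci.
congr CPState; apply: funext => k; first by rewrite (negbTE Ci) andbF.
by rewrite (negbTE Ci) andbF.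
Qed.

Lemma step_idle st i S (b := Num.max (v [set i]) (asp st i - delta)) :
  ~~ success st i (i |: S) -> coal st i = finset.set0 ->
  cp_step v delta st (i, S) =
  CPState (fun k => if k == i then b else asp st k)
    (fun k => if k == i then if b == v [set i] then [set i] else finset.set0
              else coal st k).
Proof.
rewrite /b /success /cp_step /= => /negbTE -> Ci.
congr CPState; apply: funext => k; rewrite Ci !eqxx ?andbT//.
by case: (eqVneq k i) => //= ->; rewrite Ci.
Qed.

(** * The invariant of reachable states *)

Section Invariant.
(* [lo] is never crossed downwards, since failures do not go below v({i});
   [up] then bounds a_i because a formed coalition J satisfies a(J) <= v(J). *)
Variables lo up : R.
Hypothesis v0 : v finset.set0 = 0.
Hypothesis vmul : forall J, multiple_of delta (v J).
Hypothesis lo_le0 : lo <= 0.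
Hypothesis lo_v : forall J, lo <= v J.
Hypothesis v_up : forall J, v J - n%:R * lo <= up.

(** [inv_sum] is only an inequality: a success raises one aspiration by [delta] and may leave slack
    in the new coalition. *)
Record inv st : Prop := Inv {
  inv_mul : forall i, multiple_of delta (asp st i);
  inv_cons : consistent (coal st);
  inv_sum : forall i, \sum_(j in coal st i) asp st j <= v (coal st i);
  inv_bnd : forall i, lo <= asp st i <= up }.

Lemma inv_success st i S : inv st -> success st i (i |: S) ->
  inv (cp_step v delta st (i, S)).
Proof.
move=> [am [C1 C2] Cs ab] h; rewrite step_success//; set J := i |: S.
have iJ : i \in J by rewrite setU11.
set a' := fun k => if k == i then asp st k + delta else asp st k.
have sJ : \sum_(j in J) a' j = \sum_(j in J) asp st j + delta.
  rewrite (@sum_upd _ i (asp st))// /a' ?eqxx; first by lra.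
  by move=> j /negbTE ->.
(* A surviving coalition avoids [J]: by consistency, a common member would hold this same coalition
   and so dissolve it. *)
have disj k : k \notin J -> ~~ [exists j in J, (k \in coal st j) && (k != j)] ->
    forall j, j \in coal st k -> j \notin J.
  move=> kJ /existsPn h1 j jk; apply/negP => jJ.
  have /negP := h1 j; apply; rewrite jJ (C2 _ _ jk) C1/=; last first.
    by apply/set0Pn; exists j.
  by apply: contraNneq kJ => ->.
split => /=.
- move=> k; rewrite /a'; case: eqP => // _; apply: multiple_ofD => //; exact: multiple_of_delta.
- split.
  + move=> k; case: ifPn => // kJ; case: ifPn => [|_]; last exact: C1.
    by rewrite eqxx.
  + move=> k l; case: ifPn => [kJ ->//|kJ]; case: ifPn => [|nk]; first by rewrite inE.
    move=> lk; have lJ := disj _ kJ nk _ lk; rewrite (negbTE lJ) (C2 _ _ lk).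
    case: ifPn => // /existsP[j /and3P[jJ lj lnj]].
    have kj : coal st k = coal st j by rewrite -(C2 _ _ lk) -(C2 _ _ lj).
    case/existsP: nk; exists j; rewrite jJ -kj C1 /=; last by apply/set0Pn; exists l.
    by apply: contraNneq kJ => ->.
- move=> k; case: ifPn => [kJ|kJ]; first by rewrite sJ.
  case: ifPn => [_|nk]; first by rewrite big_set0 v0.
  rewrite (eq_bigr (asp st)) => [|j jk]; first exact: Cs.
  by rewrite /a'; case: eqP (disj _ kJ nk _ jk) => // ->; rewrite iJ.
- move=> k; rewrite /a'; case: (eqVneq k i) => [->|_]; last exact: ab.
  apply/andP; split; first by have := delta_gt0; case/andP: (ab i); lra.
  (* The other members of [J] hold at least [lo] each, and there are at most [n] of them. *)
  have : \sum_(j in J) a' j <= v J by rewrite sJ.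
  rewrite (big_setD1 i)//= {1}/a' eqxx.
  have : \sum_(j in J :\ i) lo <= \sum_(j in J :\ i) a' j.
    apply: ler_sum => j; rewrite !inE /a' => /andP[/negbTE -> _].
    by case/andP: (ab j).
  rewrite sumr_const -mulr_natl.
  have : n%:R * lo <= #|J :\ i|%:R * lo.
    by apply: ler_wnM2r => //; rewrite ler_nat -[leqRHS]card_ord max_card.
  by have := v_up J; lra.
Qed.

Lemma inv_idle st i S : inv st -> ~~ success st i (i |: S) ->
  coal st i = finset.set0 -> inv (cp_step v delta st (i, S)).
Proof.
move=> [am [C1 C2] Cs ab] h Ci; rewrite step_idle//.
set b := Num.max _ _.
(* An idle player lies in nobody's coalition, so lowering his aspiration disturbs no existing
   sum. *)
have nC k : i \notin coal st k.
  by apply/negP => ik; move: (ik); rewrite -(C2 _ _ ik) Ci inE.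
split => /=.
- move=> k; case: eqP => // _; rewrite /b; case: (leP (v [set i])) => _ //.
  by apply: multiple_ofD => //; apply: multiple_ofN; exact: multiple_of_delta.
- split.
  + move=> k; case: (eqVneq k i) => [->|_]; last exact: C1.
    by case: ifP; rewrite ?eqxx ?inE.
  + move=> k l; case: (eqVneq k i) => [_|ki].
      by case: ifPn => hb; rewrite inE => // /eqP ->; rewrite eqxx.
    move=> lk; case: (eqVneq l i) lk => [->|_]; first by rewrite (negbTE (nC k)).
    exact: C2.
- move=> k; case: (eqVneq k i) => [_|ki].
    case: ifPn => [/eqP hb|_]; last by rewrite big_set0 v0.
    by rewrite big_set1 eqxx hb.
  rewrite (eq_bigr (asp st)) => [|j jk]; first exact: Cs.
  by case: eqP jk => // ->; rewrite (negbTE (nC k)).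
- move=> k; case: (eqVneq k i) => [_|_]; last exact: ab.
  have d0 := delta_gt0; have l1 := lo_v [set i]; have /andP[l2 l3] := ab i.
  have l4 := v_up [set i]; have l5 : n%:R * lo <= 0 by rewrite mulr_ge0_le0.
  by rewrite /b; case: (leP (v [set i])) => hb; apply/andP; split; lra.
Qed.

Lemma inv_step st c : inv st -> inv (cp_step v delta st c).
Proof.
case: c => i S ist; have [h|h] := boolP (success st i (i |: S)).
  exact: inv_success.
have [Ci|Ci] := eqVneq (coal st i) finset.set0; first exact: inv_idle.
by rewrite step_busy.
Qed.

(** * Final states, and words of choices that reach them *)

Definition run st (w : seq (cp_choice n)) := foldl (cp_step v delta) st w.

Lemma inv_run st w : inv st -> inv (run st w).
Proof. by elim: w st => //= c w IH st ist; apply/IH/inv_step. Qed.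

Definition final st :=
  core_solution v (asp st) (formed st) /\ forall i, coal st i != finset.set0.

Lemma final_stable st : final st -> forall J, v J <= \sum_(j in J) asp st j.
Proof. by move=> [[_ []]]. Qed.

Lemma stable_no_success st i J : (forall J, v J <= \sum_(j in J) asp st j) ->
  ~~ success st i J.
Proof. by move=> /(_ J) h; rewrite /success -ltNge; have := delta_gt0; lra. Qed.

(** Core stability rules out every success, and a failed proposal by a busy player changes
    nothing. *)
Lemma final_step st c : final st -> cp_step v delta st c = st.
Proof.
case: c => i S fst; apply: step_busy; last by case: fst.
exact/stable_no_success/final_stable.
Qed.

Lemma final_run st w : final st -> run st w = st.
Proof. by move=> fst; elim: w => //= c w IH; rewrite final_step. Qed.

Definition admissible (c : cp_choice n) := c.1 \notin c.2.

Definition absorbable st :=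
  exists2 w, all admissible w & final (run st w).

Lemma absorbable_run st w : all admissible w -> absorbable (run st w) ->
  absorbable st.
Proof.
move=> aw [w' aw' f]; exists (w ++ w'); first by rewrite all_cat aw.
by rewrite /run foldl_cat.
Qed.

(** Membership [k \in B i] is an equivalence relation with classes [B i]. *)
Lemma consistent_partition (B : 'I_n -> {set 'I_n}) :
  (forall i, i \in B i) -> (forall i k, k \in B i -> B k = B i) ->
  finset.partition [set B i | i : 'I_n] [set: 'I_n].
Proof.
move=> B1 B2; apply/and3P; split.
- rewrite finset.eqEsubset finset.subsetT; apply/fintype.subsetP => i _.
  by apply/finset.bigcupP; exists (B i) => //; apply: imset_f.
- apply/finset.trivIsetP => _ _ /imsetP[i _ ->] /imsetP[j _ ->] ij.
  apply/pred0P => k /=; apply/negbTE; apply: contra ij => /andP[/B2 <- /B2 <-].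
  by [].
- by apply/negP => /imsetP[i _ hi]; have := B1 i; rewrite -hi inE.
Qed.

(** Feasibility from [inv_sum] and stability squeeze each coalition's sum to its value. *)
Lemma final_of_busy st : inv st -> (forall J, v J <= \sum_(j in J) asp st j) ->
  (forall i, coal st i != finset.set0) -> final st.
Proof.
move=> [_ [C1 C2] Cs _] stab busy; split => //.
have C1' i : i \in coal st i by exact: C1.
have E : formed st = [set coal st i | i : 'I_n].
  apply/finset.setP => S; rewrite !inE; case: (eqVneq S) => //= ->; apply/esym/negbTE.
  by apply/negP => /imsetP[i _ /esym/eqP]; apply/negP.
rewrite /core_solution E; split; [exact: consistent_partition|split=> //].
move=> _ /imsetP[i _ ->]; apply/eqP; rewrite eq_le stab andbT; exact: Cs.
Qed.

(* Induction on the number of players outside the blocks of rho, then on the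
   number of idle players: an idle i with a_i = v({i}) cannot go below, and an
   activation merely turns him into the coalition {i}. *)
Lemma absorbable_core_asp (rho : {set {set 'I_n}}) st :
  finset.partition rho [set: 'I_n] -> inv st ->
  (forall J, v J <= \sum_(j in J) asp st j) ->
  (forall S, S \in rho -> \sum_(j in S) asp st j = v S) ->
  absorbable st.
Proof.
move=> prho; have d0 := delta_gt0.
pose mis st := [set i | coal st i \notin rho].
pose idle st := [set i | coal st i == finset.set0].
(* A lexicographic order coded as one number: at most [n] players are idle, so losing one misplaced
   player outweighs any growth of [idle]. *)
have [m] := ubnP (#|mis st| * n.+1 + #|idle st|)%N.
elim: m st => // m IH st hm ist stab tight.
have [crho trho nrho] := and3P prho.
have [U0|/set0Pn[i]] := eqVneq (idle st) finset.set0.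
  exists nil => //=; apply: final_of_busy => // i.
  have : i \notin idle st by rewrite U0 inE.
  by rewrite inE.
rewrite inE => /eqP Ci.
have ns J : ~~ success st i J by exact: stable_no_success.
have [_ [C1 C2] _ _] := ist.
have stabi : v [set i] <= asp st i by have := stab [set i]; rewrite big_set1.
have mi : i \in mis st by rewrite inE Ci.
set st1 := cp_step v delta st (i, finset.set0).
have ist1 : inv st1 by exact: inv_step.
have Est1 := @step_idle st i finset.set0 (ns _) Ci; rewrite -/st1 in Est1.
have ad1 : admissible (i, finset.set0) by rewrite /admissible inE.
have [ai|ai] := eqVneq (asp st i) (v [set i]).
  have Emax : Num.max (v [set i]) (asp st i - delta) = asp st i.
    by rewrite max_l ai//; lra.
  rewrite Emax ai eqxx in Est1.
  have Ea : asp st1 = asp st.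
    by rewrite Est1; apply: funext => k /=; case: eqP => // ->.
  apply: (@absorbable_run _ [:: (i, finset.set0)]); first by rewrite /= ad1.
  apply: IH => //; [|by rewrite /= -/st1 Ea..].
  have le1 : (#|mis st1| <= #|mis st|)%N.
    apply/subset_leq_card/fintype.subsetP => k; rewrite Est1 !inE /=.
    by case: (eqVneq k i) => // ->; rewrite Ci nrho.
  have lt2 : (#|idle st1| < #|idle st|)%N.
    apply/proper_card/properP; split.
      apply/fintype.subsetP => k; rewrite Est1 !inE /=.
      by case: (eqVneq k i) => // ->; rewrite Ci.
    exists i; first by rewrite inE Ci.
    by rewrite inE Est1 /= eqxx; apply/set0Pn; exists i; rewrite inE.
  rewrite /= -/st1 -ltnS; apply: leq_ltn_trans hm; rewrite -addnS.
  by apply: leq_add => //; rewrite leq_mul2r le1 orbT.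
have {}ai : v [set i] < asp st i by rewrite lt_neqAle eq_sym ai.
have := multiple_of_lt (vmul [set i]) (inv_mul ist i) ai => ai'.
have Emax : Num.max (v [set i]) (asp st i - delta) = asp st i - delta.
  by rewrite max_r//; lra.
rewrite Emax in Est1.
pose S := finset.pblock rho i.
have icov : i \in finset.cover rho by rewrite (eqP crho) inE.
have iS : i \in S by rewrite finset.mem_pblock.
have Srho : S \in rho by rewrite finset.pblock_mem.
have ES : i |: (S :\ i) = S by rewrite finset.setD1K.
set st2 := cp_step v delta st1 (i, S :\ i).
(* Tightness on [S] leaves a slack of exactly [delta] once [i] has stepped down. *)
have s2 : success st1 i (i |: (S :\ i)).
  rewrite ES /success (@sum_upd _ i (asp st))//.
    by rewrite Est1 /= eqxx tight//; lra.
  by move=> j /negbTE; rewrite Est1 /= => ->.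
have Est2 := step_success s2; rewrite ES -/st2 in Est2.
have Ea : asp st2 = asp st.
  rewrite Est2; apply: funext => k /=; rewrite Est1 /=.
  by case: eqP => // ->; lra.
apply: (@absorbable_run _ [:: (i, finset.set0); (i, S :\ i)]).
  by rewrite /= ad1 /admissible /= !inE eqxx.
have ist2 : inv st2 by exact: inv_step.
apply: IH => //; rewrite /= -/st1 -/st2; [|by rewrite Ea..].
suff lt1 : (#|mis st2| < #|mis st|)%N.
  have : (#|idle st2| <= n)%N by rewrite -[leqRHS]card_ord max_card.
  rewrite -ltnS -addnS => lt2; rewrite -ltnS; apply: leq_ltn_trans hm.
  apply: leq_trans (leq_addr _ _); apply: leq_trans (leq_mul lt1 (leqnn _)).
  by rewrite mulSn addnC leq_add2r.
apply/proper_card/properP; split; last first.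
  by exists i => //; rewrite inE Est2 /= iS Srho.
(* No well-placed player is displaced: a dissolved coalition meets [S], so if it were a block of
   [rho] it would be [S] itself. *)
apply/fintype.subsetP => k; rewrite !inE Est2 /=.
case: ifPn => [_|kS]; first by rewrite Srho.
have ki : k != i by apply: contraNneq kS => ->.
have Ek : coal st1 k = coal st k by rewrite Est1 /= (negbTE ki).
case: ifPn => [/existsP[j /and3P[jS kj knj]] _|_]; last by rewrite Ek.
have [ji|ji] := eqVneq j i.
  by move: kj; rewrite ji Est1 /= eqxx; case: ifP; rewrite inE// (negbTE ki).
move: kj; rewrite Est1 /= (negbTE ji) => kj.
rewrite (C2 _ _ kj); apply/negP => Cjrho.
have jj : j \in coal st j by apply: C1; apply/set0Pn; exists k.
move/negP: kS; apply; rewrite /S.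
rewrite (finset.def_pblock trho Srho iS) -(finset.def_pblock trho Srho jS).
by rewrite (finset.def_pblock trho Cjrho jj).
Qed.

(** Induction on the l1 distance from the aspirations to [x], which each move towards [x] lowers by
    exactly [delta]. *)
Lemma absorbable_inv (x : 'I_n -> R) (rho : {set {set 'I_n}}) st :
  core_solution v x rho -> (forall i, multiple_of delta (x i)) ->
  inv st -> absorbable st.
Proof.
move=> [prho [xs xt]] xm; have d0 := delta_gt0.
pose dist st := \sum_(i in [set: 'I_n]) `|asp st i - x i|.
have dist_upd s1 s2 i : (forall j, j != i -> asp s2 j = asp s1 j) ->
    `|asp s2 i - x i| = `|asp s1 i - x i| - delta -> dist s2 = dist s1 - delta.
  move=> h1 h2; rewrite /dist (@sum_upd _ i (fun j => `|asp s1 j - x j|)) ?inE//.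
    by rewrite h2; lra.
  by move=> j /h1 ->.
have [m] : exists m : nat, dist st < m%:R * delta.
  exists (Num.bound (dist st / delta)); rewrite -ltr_pdivrMr//.
  apply: archi_boundP; apply: divr_ge0; last exact: ltW.
  by apply: sumr_ge0.
elim: m st => [|m IH] st hm ist.
  by have : 0 <= dist st by [apply: sumr_ge0]; lra.
have next i S : admissible (i, S) -> dist (cp_step v delta st (i, S)) = dist st - delta ->
    absorbable st.
  move=> ad hd; apply: (@absorbable_run _ [:: (i, S)]); first by rewrite /= ad.
  apply: IH; last exact: inv_step.
  by rewrite /= hd; move: hm; rewrite -natr1; lra.
have am := inv_mul ist.
have [[J hJ]|stab] := pselect (exists J, \sum_(j in J) asp st j + delta <= v J).
  have [i iJ ix] : exists2 i, i \in J & asp st i < x i.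
    apply: contrapT => h; have : \sum_(j in J) x j <= \sum_(j in J) asp st j.
      by apply: ler_sum => j jJ; rewrite leNgt; apply/negP => hj; apply: h; exists j.
    by have := xs J; lra.
  have ix' := multiple_of_lt (am i) (xm i) ix.
  apply: (next i (J :\ i)); first by rewrite /admissible !inE eqxx.
  apply: (dist_upd _ _ i); rewrite step_success /success ?finset.setD1K//=.
    by move=> j /negbTE ->.
  by rewrite eqxx !ler0_norm; lra.
have {}stab J : v J <= \sum_(j in J) asp st j.
  rewrite leNgt; apply/negP => hJ; apply: stab; exists J.
  by apply: multiple_of_lt => //; exact: multiple_of_sum.
have [[i [Ci ix]]|idle_le] :=
    pselect (exists i, coal st i = finset.set0 /\ x i < asp st i).
  have ix' := multiple_of_lt (xm i) (am i) ix.
  (* The floor v({i}) is at most [x i], so it does not cut the decrement short. *)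
  have xv : v [set i] <= x i by have := xs [set i]; rewrite big_set1.
  apply: (next i finset.set0); first by rewrite /admissible inE.
  have ns : ~~ success st i (i |: finset.set0) by exact: stable_no_success.
  apply: (dist_upd _ _ i); rewrite step_idle//=; first by move=> j /negbTE ->.
  by rewrite eqxx max_r; [rewrite !ger0_norm|]; lra.
apply: (@absorbable_core_asp rho) => // S Srho.
have [_ [C1 C2] Cs _] := ist.
(* Idle players are added as singletons to obtain a partition of all players; summing over it bounds
   the total aspiration by the total of [x]. *)
pose B i := if coal st i == finset.set0 then [set i] else coal st i.
have prB : finset.partition [set B i | i : 'I_n] [set: 'I_n].
  apply: consistent_partition => [i|i k]; rewrite /B.
    by case: eqVneq => [_|/C1//]; rewrite inE.
  case: (eqVneq (coal st i)) => [Ci|Ci].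
    by rewrite inE => /eqP ->; rewrite Ci eqxx.
  by move=> /C2 ->; rewrite (negbTE Ci).
have le1 : \sum_(i in [set: 'I_n]) asp st i <= \sum_(i in [set: 'I_n]) x i.
  rewrite !(set_partition_big _ prB) /=; apply: ler_sum => _ /imsetP[i _ ->].
  rewrite /B; case: eqVneq => [Ci|Ci].
    by rewrite !big_set1 leNgt; apply/negP => h; apply: idle_le; exists i.
  by apply: le_trans (Cs i) _; exact: xs.
have nn S' : S' \in rho -> 0 <= \sum_(j in S') asp st j - v S'.
  by move=> _; rewrite subr_ge0.
(* The excesses over [rho] are nonnegative, and their sum is at most 0 because [x] is tight on
   [rho]. *)
have : \sum_(S' in rho) (\sum_(j in S') asp st j - v S') = 0.
  apply/eqP; rewrite eq_le sumr_ge0// andbT sumrB subr_le0.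
  apply: le_trans (_ : \sum_(i in [set: 'I_n]) x i <= _).
    by move: le1; rewrite [in X in X -> _](set_partition_big _ prho).
  by rewrite (set_partition_big _ prho) /=; apply: ler_sum => S' /xt ->.
by move=> /(psumr_eq0P nn) /(_ _ Srho) /eqP; rewrite subr_eq0 => /eqP.
Qed.

(** * One word that finishes all states at once *)

Lemma synchronizing_word : (forall st, inv st -> absorbable st) ->
  exists2 w, all admissible w & forall st, inv st -> final (run st w).
Proof.
move=> habs; have d0 := delta_gt0.
have [M hM] : exists M : nat, `|lo| + `|up| < M%:R * delta.
  exists (Num.bound ((`|lo| + `|up|) / delta)); rewrite -ltr_pdivrMr//.
  by apply: archi_boundP; apply: divr_ge0; [exact: addr_ge0|exact: ltW].
(* Index k encodes the aspiration (k - M) [delta]; the choice of [M] makes these grid points cover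
   the range from [lo] to [up]. *)
pose E : finType := ({ffun 'I_n -> 'I_(M + M).+1} * {ffun 'I_n -> {set 'I_n}})%type.
pose dec (e : E) := CPState (fun i => ((e.1 i)%:R - M%:R) * delta) e.2.
have dec_surj st : inv st -> exists e, st = dec e.
  case: st => a C ist.
  have ha i : exists k : 'I_(M + M).+1, a i = (k%:R - M%:R) * delta.
    have [z hz] := inv_mul ist i; have /= /andP[al au] := inv_bnd ist i.
    rewrite /= in hz; rewrite hz in al au *.
    have := ler_norm up; have := ler_norm (- lo); rewrite normrN => h1 h2.
    have h3 : z%:~R * delta < (M%:Z)%:~R * delta.
      by have := normr_ge0 lo; rewrite /= -pmulrn; lra.
    have h4 : (- M%:Z)%:~R * delta < z%:~R * delta.
      by have := normr_ge0 up; rewrite mulrNz -pmulrn; lra.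
    move: h3 h4; rewrite !ltr_pM2r// !ltr_int => h3 h4.
    have h5 : (absz (z + M%:Z)%R < (M + M).+1)%N by lia.
    exists (Ordinal h5) => /=; congr (_ * _).
    have -> : z = (absz (z + M%:Z))%:Z - M%:Z by lia.
    by rewrite intrB -!pmulrn; congr (_%:R - _); lia.
  have [f hf] := choice ha.
  exists ([ffun i => f i], [ffun i => C i]); congr CPState.
    by apply: funext => i; rewrite ffunE hf.
  by apply: funext => i; rewrite ffunE.
suff [w aw hw] : exists2 w, all admissible w &
    forall e, e \in enum {: E} -> inv (dec e) -> final (run (dec e) w).
  exists w => // st ist; have [e he] := dec_surj _ ist.
  by rewrite he; apply: hw; rewrite ?mem_enum -?he.
elim: (enum {: E}) => [|e l [w aw hw]]; first by exists nil.
have [ie|nie] := pselect (inv (dec e)); last first.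
  by exists w => // e'; rewrite inE => /predU1P[->//|]; exact: hw.
(* [w'] starts from where [w] leaves [dec e]; the states already finished by [w] are fixed under
   it. *)
have [w' aw' f] := habs _ (inv_run w ie).
exists (w ++ w'); first by rewrite all_cat aw.
move=> e'; rewrite inE /run foldl_cat => /predU1P[->//|el] ie'.
by have fe := hw _ el ie'; rewrite -/(run _ _) -/(run _ _) final_run.
Qed.

End Invariant.

(** * Finite words inside an infinite run *)

Lemma cp_run_add a0 ch (m : nat) w :
  (forall j : nat, (j < size w)%N -> ch (m + j)%N = nth (ch 0%N) w j) ->
  cp_run v delta a0 ch (m + size w) = run (cp_run v delta a0 ch m) w.
Proof.
elim: w m => [|c w IH] m h; first by rewrite addn0.
rewrite /= -addSnnS IH; last first.
  by move=> j jw; rewrite addSnnS h.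
by rewrite /=; have := h 0%N isT; rewrite addn0 /= => ->.
Qed.

Lemma cp_run_final a0 ch (m k : nat) : final (cp_run v delta a0 ch m) -> (m <= k)%N ->
  cp_run v delta a0 ch k = cp_run v delta a0 ch m.
Proof.
move=> f /subnKC <-; elim: (k - m)%N => [|l IH]; first by rewrite addn0.
by rewrite addnS /= IH final_step.
Qed.

End Dynamics.

(** * Almost sure occurrence of one of infinitely many independent blocks *)

Section IndependentEvents.
Local Open Scope classical_set_scope.
Local Set Implicit Arguments.
Variables (R : realType) (d : measure_display) (T : measurableType d).
Variables (P : probability T R) (E : nat -> set T) (q : nat -> R).
Hypothesis mE : forall k, measurable (E k).
Let cyl (s : seq nat) : set T := [set w | forall k, k \in s -> E k w].
Hypothesis indep : forall s, uniq s -> P (cyl s) = (\prod_(k <- s) q k)%:E.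
Variables (L : nat) (eps : R).
Let block k := iota (k * L)%N L.
Hypothesis block_prob : forall k, \prod_(j <- block k) q j = eps.
Hypothesis eps_gt0 : 0 < eps.

Let missed K : set T := [set w | forall k, (k < K)%N -> ~ cyl (block k) w].

Let cyl_cat s t : cyl (s ++ t) = cyl s `&` cyl t.
Proof.
apply/seteqP; split => [w h|w [h1 h2] k].
  by split=> k ks; apply: h; rewrite mem_cat ks ?orbT.
by rewrite mem_cat => /orP[/h1|/h2].
Qed.

Let measurable_cyl s : measurable (cyl s).
Proof.
elim: s => [|k s IH].
  by rewrite [cyl _](_ : _ = setT)//; apply/seteqP; split.
rewrite -cat1s cyl_cat; apply: measurableI => //.
rewrite [cyl _](_ : _ = E k)//; apply/seteqP; split=> w; last first.
  by move=> h j; rewrite inE => /eqP ->.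
by apply; rewrite inE.
Qed.

Let missedS K : missed K.+1 = missed K `\` cyl (block K).
Proof.
apply/seteqP; split => [w h|w [h1 h2] k].
  by split=> [k kK|]; apply: h => //; exact: ltnW.
by rewrite ltnS leq_eqVlt => /predU1P[->//|]; exact: h1.
Qed.

Let measurable_missed K : measurable (missed K).
Proof.
elim: K => [|K IH].
  by rewrite [missed _](_ : _ = setT)//; apply/seteqP; split.
by rewrite missedS; exact: measurableD.
Qed.

(* The later cylinder [s] makes the induction close with the product rule for
   the events themselves, without their complements: missing block K as well
   amounts to subtracting the same formula for [block K ++ s]. *)
Let missed_prob K s : uniq s -> (forall j, j \in s -> (K * L <= j)%N) ->
  P (missed K `&` cyl s) = ((1 - eps) ^+ K * \prod_(k <- s) q k)%:E.
Proof.
elim: K s => [|K IH] s us hs.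
  rewrite expr0 mul1r -indep//; congr (P _).
  by apply/seteqP; split=> [w []//|w h].
have -> : missed K.+1 `&` cyl s =
    (missed K `&` cyl s) `\` (missed K `&` cyl (block K ++ s)).
  rewrite missedS cyl_cat; apply/seteqP; split => w /=; first tauto.
  by move=> [[h1 h2] h3]; split=> //; split=> // h4; apply: h3.
have hs' j : j \in s -> (K * L <= j)%N.
  by move=> /hs; apply: leq_trans; rewrite leq_mul2r leqnSn orbT.
have mI t : measurable (missed K `&` cyl t) by exact: measurableI.
have fin : (P (missed K `&` cyl s) < +oo)%E by rewrite IH// ltry.
set A := missed K `&` cyl s; set B := missed K `&` cyl _.
have -> : P (A `\` B) = (P A - P (A `&` B))%E by apply: measureD; rewrite /A /B.
have -> : A `&` B = B.
  by rewrite /A /B cyl_cat; apply/seteqP; split => w /=; tauto.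
rewrite /A /B !IH//.
- rewrite big_cat/= block_prob -EFinB exprSr; congr EFin.
  by rewrite mulrBr mulr1 mulrBl mulrA.
- rewrite cat_uniq iota_uniq us andbT /=; apply/hasPn => j /hs.
  by rewrite mulSn /= mem_iota => h; apply/negP => /andP[_]; lia.
- by move=> j; rewrite mem_cat mem_iota => /orP[/andP[]//|]; exact: hs'.
Qed.

(** The first K blocks are all missed with probability (1 - [eps])^K, which tends to 0. *)
Lemma block_occurs_ae :
  exists A : set T, measurable A /\ P A = 1%E /\
    forall w, A w -> exists k, cyl (block k) w.
Proof.
pose N := \bigcap_K missed K.
have mN : measurable N by exact: bigcap_measurable.
have le1 : eps <= 1.
  rewrite -lee_fin -(block_prob 0) -indep ?iota_uniq//; exact: probability_le1.
have PK K : (P N <= ((1 - eps) ^+ K)%:E)%E.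
  rewrite -[in leRHS](mulr1 ((1 - eps) ^+ K)).
  rewrite -[X in (_ * X)%:E](big_nil 1 *%R xpredT q) -missed_prob//.
  apply: le_measure; rewrite ?inE//; first exact: measurableI.
  by move=> w h; split=> //; exact: h.
have PN : P N = 0%E.
  apply/eqP; rewrite eq_le measure_ge0 andbT.
  have fP : P N \is a fin_num by exact: fin_num_measure.
  rewrite -(fineK fP) lee_fin.
  have /cvg_expr c0 : `|1 - eps| < 1 by rewrite ger0_norm; have := eps_gt0; lra.
  rewrite -(cvg_lim _ c0)//; apply: limr_ge; first exact: cvgP c0.
  by apply: nearW => K; rewrite -lee_fin fineK// PK.
exists (~` N); split; first exact: measurableC.
split; first by rewrite probability_setC// PN sube0.
move=> w hw; apply: contrapT => h; apply: hw => K _ k _ hk.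
by apply: h; exists k.
Qed.

End IndependentEvents.

(** * Almost sure convergence of the algorithm *)

Local Open Scope classical_set_scope.

Theorem theorem1 (R : realType) (n : nat) (v : {set 'I_n} -> R) (delta : R)
  (d : measure_display) (T : measurableType d) (P : probability T R)
  (X : nat -> T -> cp_choice n) (p : cp_choice n -> R)
  (a0 : 'I_n -> R) :
  tu_game v ->
  (exists (x : 'I_n -> R) (rho : {set {set 'I_n}}), core_solution v x rho) ->
  0 < delta ->
  (forall S : {set 'I_n}, multiple_of delta (v S)) ->
  (exists (x : 'I_n -> R) (rho : {set {set 'I_n}}),
     core_solution v x rho /\ forall i, multiple_of delta (x i)) ->
  (* initial aspirations are integer multiples of delta *)
  (forall i, multiple_of delta (a0 i)) ->
  (* every admissible choice (i, S), S a subset of N \ {i}, has positive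
     probability p (i, S); inadmissible ones have probability 0 *)
  (forall c : cp_choice n, c.1 \notin c.2 -> 0 < p c) ->
  (forall c : cp_choice n, c.1 \in c.2 -> p c = 0) ->
  (* the choices X k are measurable, independent, with common law p *)
  (forall k (c : cp_choice n), measurable [set w | X k w = c]) ->
  (forall (s : seq nat) (c : nat -> cp_choice n), uniq s ->
     P [set w | forall k, k \in s -> X k w = c k] = (\prod_(k <- s) p (c k))%:E) ->
  (* almost surely, the state eventually equals some core solution *)
  exists A : set T, measurable A /\ P A = 1%E /\
    forall w, A w ->
      exists (x : 'I_n -> R) (rho : {set {set 'I_n}}),
        core_solution v x rho /\
        exists K : nat, forall k, (K <= k)%N ->
          asp (cp_run v delta a0 (fun j => X j w) k) = x /\
          formed (cp_run v delta a0 (fun j => X j w) k) = rho.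
Proof.
move=> v0 _ d0 vm [x [rho [core xm]]] a0m p_gt0 _ mX indep.
(* [B] dominates all initial aspirations and all values, so [- B] and [up] can serve as the bounds
   of the invariant. *)
pose B := \sum_i `|a0 i| + \sum_(J : {set 'I_n}) `|v J|.
have sa : 0 <= \sum_i `|a0 i| by apply: sumr_ge0.
have sv : 0 <= \sum_(J : {set 'I_n}) `|v J| by apply: sumr_ge0.
have vB J : `|v J| <= B.
  rewrite /B (bigD1 J)//= ler_wpDl// ler_wpDr//; exact: sumr_ge0.
have aB i : `|a0 i| <= B.
  rewrite /B (bigD1 i)//= -addrA ler_wpDr// addr_ge0//; exact: sumr_ge0.
have B0 : 0 <= B by rewrite addr_ge0.
have nB : 0 <= n%:R * B by rewrite mulr_ge0.
pose up := B + n%:R * B.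
have loB : - B <= 0 by rewrite oppr_le0.
have lov J : - B <= v J by have := vB J; rewrite ler_norml => /andP[].
have vup J : v J - n%:R * - B <= up.
  by have := vB J; rewrite ler_norml mulrN opprK /up => /andP[_]; lra.
pose st0 : cp_state R n := CPState a0 (fun=> finset.set0).
have inv0 : inv v delta (- B) up st0.
  split=> //=.
  - by split=> [i|i k]; rewrite ?eqxx ?inE.
  - by move=> i; rewrite big_set0 v0.
  - by move=> i; have := aB i; rewrite ler_norml /up => /andP[]; lra.
have [W adW finW] := synchronizing_word d0 v0 vm loB lov vup
  (fun st => @absorbable_inv _ _ _ _ d0 _ _ v0 vm loB lov vup _ _ st core xm).
(* [nth] needs a default choice, but [cp_choice n] is empty for n = 0; total mass 1 gives a point
   [w0], hence the choice [X 0 w0]. *)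
have [w0 _] : exists w : T, True.
  apply: contrapT => h.
  have : P [set: T] = 1%E by exact: probability_setT.
  rewrite [X in P X](_ : _ = set0) ?measure0.
    by move=> /eqP; rewrite eqe eq_sym oner_eq0.
  by apply/seteqP; split=> // w _; apply: h; exists w.
(* [W] repeated periodically, so that every block of length [size W] spells [W]. *)
pose c j := nth (X 0%N w0) W (j %% size W).
have cW k j : (j < size W)%N -> c (k * size W + j)%N = nth (X 0%N w0) W j.
  by move=> jW; rewrite /c modnMDl modn_small.
have blockE k : \prod_(j <- iota (k * size W)%N (size W)) p (c j) = \prod_(a <- W) p a.
  rewrite -[(k * size W)%N]addn0 iotaDl big_map [RHS](big_nth (X 0%N w0)) /index_iota subn0.
  by apply: eq_big_seq => j; rewrite mem_iota => /andP[_ jW]; rewrite cW.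
have eps_gt0 : 0 < \prod_(a <- W) p a.
  elim: (W) adW => [|a s IH]; first by rewrite big_nil.
  by rewrite /= big_cons => /andP[/p_gt0 pa /IH]; exact: mulr_gt0.
have [A [mA [PA hA]]] := @block_occurs_ae R _ T P (fun j => [set w | X j w = c j])
  (fun j => p (c j)) (fun j => mX j _) (fun s us => indep s c us) _ _ blockE eps_gt0.
exists A; split=> //; split=> // w /hA[k hk].
set ch := fun j => X j w.
pose st := cp_run v delta a0 ch (k * size W + size W).
have fst_ : final v st.
  rewrite /st cp_run_add; last first.
    move=> j jW; rewrite /ch hk ?mem_iota ?leq_addr ?ltn_add2l//.
    by rewrite cW//; apply: set_nth_default.
  apply: finW; elim: (k * size W)%N => //= m; exact: inv_step.
exists (asp st), (formed st); split; first by case: fst_.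
by exists (k * size W + size W)%N => l hl; rewrite (cp_run_final d0 fst_ hl).
Qed.
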